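(* For every $2\le m,n\le\infty$, the class $\mathcal A_{T_{m,n}}$ has no precompact Ramsey expansion.
   Context: For $2\le m,n\le\infty$, $T_{m,n}$ is the countable connected regular tree-like graph in which every block (maximal 2-connected subgraph) is a clique of order $n$ and every vertex is a cut vertex lying in exactly $m$ blocks. $\mathcal A_{T_{m,n}}$ is the age of the metric space on the vertices of $T_{m,n}$ with the shortest-path distance, viewed as relational structures with a binary relation for each distance. An expansion of a class $\mathcal K$ of $L$-structures is a class $\mathcal K^+$ of $L^+$-structures ($L\subseteq L^+$) whose $L$-reducts are the members of $\mathcal K$; it is precompact if each $\mathbf A\in\mathcal K$ has only finitely many expansions in $\mathcal K^+$. A class $\mathcal C$ is Ramsey if for all $\mathbf A,\mathbf B\in\mathcal C$ and $k\ge1$ there is $\mathbf C\in\mathcal C$ such that for every $k$-colouring of the copies of $\mathbf A$ in $\mathbf C$ some copy of $\mathbf B$ in $\mathbf C$ has all its copies of $\mathbf A$ of one colour.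
   Formalization: The expansion is required to be closed under substructures and isomorphism, over a relational language; without this the claim fails, since marking every vertex of A by a unary predicate indexed by |A| gives a trivially Ramsey expansion with exactly one expansion of each structure. *)

(* Defs.v *)
From mathcomp Require Import all_boot.
From mathcomp Require Import boolp classical_sets functions cardinality.
Set Implicit Arguments.
Unset Strict Implicit.
Unset Printing Implicit Defensive.
Local Open Scope classical_set_scope.
Local Open Scope card_scope.

(** ** Relational structures and classes of finite structures *)

(* A relational language, as the family of its sets of k-ary symbols. *)
Definition language : Type := nat -> Type.

Definition interp (L : language) (V : Type) : Type :=
  forall k : nat, L k -> set (k.-tuple V).

Record fstruct (L : language) : Type :=
  FStruct { fdom : finType; frel : interp L fdom }.

Definition sclass (L : language) : Type := fstruct L -> Prop.

Definition embedding (L : language) (V W : Type)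
    (I : interp L V) (J : interp L W) (f : V -> W) : Prop :=
  injective f /\
  forall (k : nat) (s : L k) (t : k.-tuple V), J k s (map_tuple f t) <-> I k s t.

Definition embeds (L : language) (A B : fstruct L) : Prop :=
  exists f : fdom A -> fdom B, embedding (@frel L A) (@frel L B) f.

Definition age (L : language) (V : Type) (M : interp L V) : sclass L :=
  fun A => exists f : fdom A -> V, embedding (@frel L A) M f.

(* Closed under substructures and under isomorphism. *)
Definition hereditary (L : language) (K : sclass L) : Prop :=
  forall A B : fstruct L, embeds A B -> K B -> K A.

(* S is the vertex set of a substructure of B isomorphic to A. Since
   substructures are induced, the copies of A in such a substructure S are
   exactly the copies of A in B whose vertex set is contained in S. *)
Definition copy (L : language) (A B : fstruct L) (S : {set fdom B}) : Prop :=
  exists2 f : fdom A -> fdom B,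
    embedding (@frel L A) (@frel L B) f & S = [set f x | x : fdom A]%SET.

Definition ramsey (L : language) (K : sclass L) : Prop :=
  forall A B : fstruct L, K A -> K B -> forall k : nat, 1 <= k ->
  exists2 C : fstruct L, K C &
    forall chi : {set fdom C} -> 'I_k,
    exists2 S : {set fdom C}, copy B S &
      exists c : 'I_k, forall S' : {set fdom C},
        copy A S' -> S' \subset S -> chi S' = c.

(** ** Expansions *)

Record sublanguage (L Lp : language) : Type := Sublanguage {
  sl_map : forall k : nat, L k -> Lp k;
  sl_inj : forall k : nat, injective (@sl_map k) }.

Definition reduct_interp (L Lp : language) (i : sublanguage L Lp) (V : Type)
    (J : interp Lp V) : interp L V :=
  fun (k : nat) (s : L k) => J k (sl_map i s).

Definition reduct (L Lp : language) (i : sublanguage L Lp)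
    (A : fstruct Lp) : fstruct L :=
  FStruct (reduct_interp i (@frel Lp A)).

Definition expansion (L Lp : language) (i : sublanguage L Lp)
    (K : sclass L) (Kp : sclass Lp) : Prop :=
  forall A : fstruct L, K A <-> exists2 B : fstruct Lp, Kp B & reduct i B = A.

Definition precompact (L Lp : language) (i : sublanguage L Lp)
    (K : sclass L) (Kp : sclass Lp) : Prop :=
  forall A : fstruct L, K A ->
    finite_set [set J : interp Lp (fdom A) |
                 Kp (FStruct J) /\ reduct_interp i J = @frel L A].

(* Classes of structures are understood to be hereditary. This cannot be
   dropped for Kp: marking every vertex of A by a unary predicate U_#|A| gives,
   for any K, a non-hereditary expansion with exactly one expansion of each
   structure, in which no structure embeds in a larger one, so that the Ramsey
   property holds trivially. *)
Definition has_precompact_ramsey_expansion (L : language)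
    (K : sclass L) : Prop :=
  exists (Lp : language) (i : sublanguage L Lp) (Kp : sclass Lp),
    [/\ hereditary Kp, expansion i K Kp, precompact i K Kp & ramsey Kp].

(** ** Graphs, blocks and the trees T_{m,n} *)

(* G[S] is connected (possibly empty). *)
Definition connected_on (V : eqType) (e : rel V) (S : set V) : Prop :=
  forall x y : V, S x -> S y ->
  exists p : seq V, [/\ path e x p, last x p = y & {in x :: p, forall z, S z}].

Definition cut_vertex (V : eqType) (e : rel V) (v : V) : Prop :=
  ~ connected_on e (~` [set v]).

(* Connected, without cut vertex, and with at least two vertices. The complete
   graph on two vertices qualifies, as it has to for the blocks of T_{m,2}. *)
Definition two_connected (V : eqType) (e : rel V) (S : set V) : Prop :=
  [/\ exists x y : V, [/\ S x, S y & x <> y],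
      connected_on e S
    & forall v : V, S v -> connected_on e (S `\ v)].

(* Maximal 2-connected subgraphs are induced, so a block is given by its
   vertex set. *)
Definition block (V : eqType) (e : rel V) (S : set V) : Prop :=
  two_connected e S /\
  forall S' : set V, two_connected e S' -> S `<=` S' -> S' = S.

Definition clique (V : eqType) (e : rel V) (S : set V) : Prop :=
  forall x y : V, S x -> S y -> x <> y -> e x y.

(* An element of N with oo added, None standing for oo. *)
Definition enat : Type := option nat.

Definition ge2 (n : enat) : Prop := if n is Some k then 2 <= k else True.

Definition has_card (T : Type) (S : set T) (n : enat) : Prop :=
  if n is Some k then S #= `I_k else S #= [set: nat].

(* (V, e) is T_{m,n}. *)
Record is_T (m n : enat) (V : countType) (e : rel V) : Prop := IsT {
  T_sym : symmetric e;
  T_irr : irreflexive e;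
  T_nonempty : exists v : V, True;
  T_connected : connected_on e [set: V];
  T_blocks : forall S : set V, block e S -> clique e S /\ has_card S n;
  T_cut : forall v : V, cut_vertex e v;
  T_degree : forall v : V, has_card [set S : set V | block e S /\ S v] m }.

(** ** The metric space of a graph as a relational structure *)

Definition graph_dist (V : eqType) (e : rel V) (x y : V) (d : nat) : Prop :=
  (exists p : seq V, [/\ path e x p, last x p = y & size p = d]) /\
  forall p : seq V, path e x p -> last x p = y -> d <= size p.

Inductive dist_lang : language := Dist (d : nat) : dist_lang 2.

Definition metric_interp (V : eqType) (e : rel V) : interp dist_lang V :=
  fun k s =>
    match s in dist_lang k return set (k.-tuple V) with
    | Dist d => [set t : 2.-tuple V |
                  graph_dist e (tnth t ord0) (tnth t ord_max) d]
    end.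

Definition age_T (V : countType) (e : rel V) : sclass dist_lang :=
  age (metric_interp e).

(* Main.v *)
Require Import Defs.
From mathcomp Require Import all_boot.
From mathcomp Require Import boolp classical_sets functions cardinality.
From mathcomp Require Import zify.

Set Implicit Arguments.
Unset Strict Implicit.
Unset Printing Implicit Defensive.

Local Open Scope classical_set_scope.

(** Let [N] be the number of expansions of a one-point structure. On a geodesic
    with [2N + 1] vertices, three vertices carry the same one-point expansion
    [A]. Colour each vertex of the Ramsey witness by its distance to a fixed
    root of the tree, modulo [2N + 1]. In a copy of the geodesic which is
    monochromatic for [A], these three vertices have congruent distances to the
    root; as their mutual distances are at most [2N], they are equidistant from
    the root. This is impossible: the middle vertex [y] is avoided by the
    geodesics joining the root to the outer two, so the two neighbours of [y] on
    the geodesic lie with [y] on a cycle, hence in a common block, and would be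
    adjacent. *)

(** * Walks, cycles and blocks *)

Section GraphDistance.

Variables (V : eqType) (e : rel V).
Hypothesis e_sym : symmetric e.

(** The condition that [connected_on e S] imposes on a pair of points of [S], split off so that
    walks inside [S] can be composed and reversed. *)
Definition joined (S : set V) (x y : V) : Prop :=
  exists p : seq V, [/\ path e x p, last x p = y & {in x :: p, forall z, S z}].

Lemma joined_trans S x y z : joined S x y -> joined S y z -> joined S x z.
Proof.
move=> [p [ep lp Sp]] [q [eq lq Sq]]; exists (p ++ q); split.
- by rewrite cat_path ep lp.
- by rewrite last_cat lp.
- move=> u; rewrite -cat_cons mem_cat => /orP[/Sp //|uq].
  by apply: Sq; rewrite inE uq orbT.
Qed.

Lemma rev_walk x p : path e x p ->
  exists q, [/\ path e (last x p) q, last (last x p) q = x, size q = size p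
              & last x p :: q =i x :: p].
Proof.
move=> ep; exists (rev (belast x p)); split.
- by rewrite rev_path (eq_path (e' := e)).
- by case: p {ep} => //= a p; rewrite rev_cons last_rcons.
- by rewrite size_rev size_belast.
- by move=> u; rewrite -rev_rcons -lastI mem_rev.
Qed.

Lemma joined_sym S x y : joined S x y -> joined S y x.
Proof.
move=> [p [ep lp Sp]]; have [q [eq lq _ mq]] := rev_walk ep.
by exists q; rewrite -lp; split=> // u; rewrite mq => /Sp.
Qed.

Lemma joinedS S S' x y : S `<=` S' -> joined S x y -> joined S' x y.
Proof. by move=> sS [p [ep lp Sp]]; exists p; split=> // u /Sp /sS. Qed.

Lemma connected_on_walk x p : path e x p -> connected_on e [set` x :: p].
Proof.
move=> ep; have jx u : u \in x :: p -> joined [set` x :: p] x u.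
  move=> up; case/splitPl: p / up ep => [p1 p2 lp1] ep.
  exists p1; split=> //; first by move: ep; rewrite cat_path => /andP[].
  by move=> w wp; rewrite /= -cat_cons mem_cat wp.
by move=> u w /= /jx/joined_sym xu /jx; apply: joined_trans.
Qed.

(** Rotating the cycle to start at the deleted vertex leaves the other vertices in order along a
    walk. *)
Lemma two_connected_cycle c : cycle e c -> uniq c -> 1 < size c ->
  two_connected e [set` c].
Proof.
case: c => [|x [|y c]] // cc uc _; split.
- exists x, y; split; rewrite /= ?inE ?eqxx ?orbT // => xy.
  by move: uc; rewrite /= xy inE eqxx.
- by apply: connected_on_walk; move: cc; rewrite /= rcons_path => /and3P[-> ->].
- move=> v /= vc; have [i c' rc] := rot_to vc.
  have cvc' : cycle e (v :: c') by rewrite -rc rot_cycle.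
  have uvc' : uniq (v :: c') by rewrite -rc rot_uniq.
  have -> : [set` [:: x, y & c]] `\ v = [set` c'].
    apply/seteqP; split=> u /=.
      by move=> [uc' /eqP uv]; move: uc'; rewrite -(mem_rot i) rc inE (negPf uv).
    move=> uc'; split; first by rewrite -(mem_rot i) rc inE uc' orbT.
    by move=> uv; move: uvc'; rewrite /= -uv uc'.
  case: c' {rc uvc'} cvc' => [_ ? ?|w c'] //=.
  by rewrite rcons_path => /and3P[_ ec' _]; apply: connected_on_walk.
Qed.

(** Meant for unions of two-connected sets: a vertex removed from the union may lie outside some of
    the pieces. *)
Lemma connected_on_setD1 S v :
  two_connected e S -> connected_on e (S `\ v).
Proof.
move=> [_ cS cSv]; have [/cSv //|Sv] := pselect (S v).
suff -> : S `\ v = S by [].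
by apply/seteqP; split=> [u []//|u Su]; split=> // uv; apply: Sv; rewrite -uv.
Qed.

(* The block through [x] and [y] is the union of all two-connected sets
   containing both: two points are enough to survive the removal of one. *)
Lemma two_connected_sub_block S x y : two_connected e S -> S x -> S y ->
  x <> y -> exists2 B, block e B & S `<=` B.
Proof.
move=> tS Sx Sy xy.
pose B := [set u | exists S', [/\ two_connected e S', S' x, S' y & S' u]].
have sB S' : two_connected e S' -> S' x -> S' y -> S' `<=` B.
  by move=> *; exists S'.
exists B; last exact: sB.
have tB : two_connected e B.
  split; first by exists x, y; split=> //; exact: (sB S).
  - move=> a b [S1 [t1 x1 y1 a1]] [S2 [t2 x2 y2 b2]].
    have [[_ c1 _] [_ c2 _]] := (t1, t2).
    apply: (@joined_trans _ _ x).
      by apply: (joinedS (sB _ t1 x1 y1)); exact: c1.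
    by apply: (joinedS (sB _ t2 x2 y2)); exact: c2.
  - move=> v _ a b [[S1 [t1 x1 y1 a1]] av] [[S2 [t2 x2 y2 b2]] bv].
    have s1 := sB _ t1 x1 y1; have s2 := sB _ t2 x2 y2.
    have via z : S1 z -> S2 z -> z <> v -> joined (B `\ v) a b.
      move=> z1 z2 zv; apply: (@joined_trans _ _ z).
        by apply: (@joinedS (S1 `\ v)); [exact: setSD|exact: connected_on_setD1].
      by apply: (@joinedS (S2 `\ v)); [exact: setSD|exact: connected_on_setD1].
    have [xv|] := pselect (x = v); last exact: via.
    by apply: (via y) => // yv; apply: xy; rewrite xv yv.
split=> // S' tS' sBS'; apply/seteqP; split=> // u S'u.
by exists S'; split=> //; apply: sBS'; exact: (sB S).
Qed.

(** * The path metric and its geodesics *)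

Hypothesis e_conn : connected_on e [set: V].

Let walk_len x y :=
  [pred d | `[< exists p, [/\ path e x p, last x p = y & size p = d] >]].

Lemma walk_len_ex x y : exists d, walk_len x y d.
Proof.
have [p [ep lp _]] := @e_conn x y I I.
by exists (size p); apply/asboolP; exists p.
Qed.

Definition dist x y : nat := ex_minn (walk_len_ex x y).

Lemma geodesicP x y :
  exists p, [/\ path e x p, last x p = y & size p = dist x y].
Proof. by rewrite /dist; case: ex_minnP => d /asboolP. Qed.

Lemma dist_le_walk x p : path e x p -> dist x (last x p) <= size p.
Proof.
move=> ep; rewrite /dist; case: ex_minnP => d _; apply.
by apply/asboolP; exists p.
Qed.

Lemma graph_distP x y d : graph_dist e x y d <-> dist x y = d.
Proof.
split=> [[[p [ep <- <-]] min]|<-].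
  apply/eqP; rewrite eqn_leq dist_le_walk //=.
  by have [q [eq lq <-]] := geodesicP x (last x p); exact: min.
by split=> [|p ep <-]; [exact: geodesicP|exact: dist_le_walk].
Qed.

Lemma dist_xx x : dist x x = 0.
Proof. by apply/eqP; rewrite -leqn0; exact: (@dist_le_walk x [::]). Qed.

Lemma dist_eq0 x y : dist x y = 0 -> x = y.
Proof. by have [[|a p] [_ <- <-]] := geodesicP x y. Qed.

Lemma dist_triangle y x z : dist x z <= dist x y + dist y z.
Proof.
have [p [ep lp <-]] := geodesicP x y; have [q [eq <- <-]] := geodesicP y z.
by rewrite -lp -last_cat -size_cat dist_le_walk // cat_path ep lp.
Qed.

Lemma dist_sym x y : dist x y = dist y x.
Proof.
suff le u w : dist u w <= dist w u by apply/eqP; rewrite eqn_leq !le.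
have [p [ep <- <-]] := geodesicP w u.
by have [q [/dist_le_walk + lq <- _]] := rev_walk ep; rewrite lq.
Qed.

Lemma dist_le1 x y : e x y -> dist x y <= 1.
Proof. by move=> exy; apply: (@dist_le_walk x [:: y]); rewrite /= exy. Qed.

(** A geodesic from [v] to [x] that met [y] before its end would put [y] strictly closer to [v] than
    [x]. *)
Lemma joined_geodesic v x y :
  dist v x <= dist v y -> x <> y -> joined (~` [set y]) v x.
Proof.
move=> vxy xy; have [p [ep lp sp]] := geodesicP v x; exists p; split=> // u up uy.
case/splitPl: p / up ep lp sp => [p1 p2 lp1] + lp sp.
rewrite cat_path => /andP[/dist_le_walk + _].
rewrite lp1 uy => le1; apply: xy.
have p20 : p2 = [::] by apply: size0nil; move: sp; rewrite size_cat; lia.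
by rewrite -lp p20 cats0 lp1.
Qed.

(** Take for [x'] the vertex before [y] on a geodesic: it is closer to [x] than [y] is, so a
    geodesic from [x] to [x'] misses [y]. *)
Lemma geodesic_last_step x y : x <> y ->
  exists x', [/\ e x' y, dist x y = (dist x x').+1 & joined (~` [set y]) x x'].
Proof.
move=> xy; have [p [ep lp sp]] := geodesicP x y.
case/lastP: p ep lp sp => [|p z] ep lp sp; first by case: xy.
rewrite last_rcons in lp; subst z; rewrite size_rcons in sp.
move: ep; rewrite rcons_path => /andP[ep elast].
have le1 := dist_le_walk ep; have le2 := dist_le1 elast.
have le3 := dist_triangle (last x p) x y.
exists (last x p); split=> //; first by lia.
by apply: joined_geodesic; [lia|move=> lpy; move: le1; rewrite lpy; lia].
Qed.

(** * Equidistant points when blocks are cliques *)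

Hypothesis e_blocks : forall S, block e S -> clique e S.

Lemma not_three_equidistant v x y z : x <> y -> y <> z ->
  dist x z = dist x y + dist y z ->
  dist v x = dist v y -> dist v z = dist v y -> False.
Proof.
move=> xy yz xz vx vz.
have zy : z <> y by move=> zy; apply: yz.
have [x' [ex' xx' jx]] := geodesic_last_step xy.
have [z' [ez' zz' jz]] := geodesic_last_step zy.
have vxj : joined (~` [set y]) v x by apply: joined_geodesic; rewrite ?vx.
have vzj : joined (~` [set y]) v z by apply: joined_geodesic; rewrite ?vz.
have [p [+ + yp]] : joined (~` [set y]) x' z'.
  apply: joined_trans (joined_sym jx) _; apply: joined_trans (joined_sym vxj) _.
  exact: joined_trans vzj jz.
(* The route from [x] to [z] through [x'] and [z'] is no shorter than the geodesic through [y],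
   which spends two edges between [x'] and [z']. *)
have x'z' : 1 < dist x' z'.
  have le1 := dist_triangle x' x z; have le2 := dist_triangle z' x' z.
  by move: xz le1 le2; rewrite (dist_sym y z) (dist_sym z' z); lia.
(* Shortening the walk keeps it off [y], and [y] closes the resulting simple path to a cycle. *)
case/shortenP => q eq uq sq lq.
have uc : uniq (y :: x' :: q).
  rewrite cons_uniq uq andbT; apply/negP => yq; apply: (yp y) => //.
  by move: yq; rewrite !inE => /orP[->//|/sq ->]; rewrite orbT.
have cc : cycle e (y :: x' :: q) by rewrite /= e_sym ex' rcons_path eq lq.
have x'c : [set` y :: x' :: q] x' by rewrite /= !inE eqxx orbT.
have z'c : [set` y :: x' :: q] z' by rewrite /= inE -lq mem_last orbT.
have neq : x' <> z' by move=> x'z; move: x'z'; rewrite x'z dist_xx.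
have [B /e_blocks cB sB] :=
  two_connected_sub_block (two_connected_cycle cc uc isT) x'c z'c neq.
by have /dist_le1 := cB _ _ (sB _ x'c) (sB _ z'c) neq; lia.
Qed.

(** * Arbitrarily long geodesics from cut vertices *)

Hypothesis e_cut : forall v, cut_vertex e v.

(* A vertex at maximal distance from [v0] would not be a cut vertex. *)
Lemma dist_unbounded v0 L : exists w, L <= dist v0 w.
Proof.
apply: contrapT => /forallNP bounded.
pose P := [pred d | `[< exists w, dist v0 w = d >]].
have exP : exists d, P d by exists (dist v0 v0); apply/asboolP; exists v0.
have leP d : P d -> d <= L.
  by move=> /asboolP[w <-]; have /negP := bounded w; lia.
case: (ex_maxnP exP leP) => d /asboolP[v vd] max.
have far w : dist v0 w <= dist v0 v.
  by rewrite vd; apply: max; apply/asboolP; exists w.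
apply: (e_cut (v := v)) => x y xv yv.
apply: joined_trans (joined_sym (joined_geodesic (far x) xv)) _.
exact: joined_geodesic (far y) yv.
Qed.

Lemma geodesic_exists (v0 : V) L : exists x : nat -> V,
  forall s t, s <= t <= L -> dist (x s) (x t) = t - s.
Proof.
have [w Lw] := dist_unbounded v0 L; have [p [ep lp sp]] := geodesicP v0 w.
pose x t := last v0 (take t p); exists x.
have le s t : s <= t -> t <= size p -> dist (x s) (x t) <= t - s.
  move=> st tp; have tE : take t p = take s p ++ take (t - s) (drop s p).
    by rewrite -takeD subnKC.
  have := take_path t ep; rewrite tE cat_path => /andP[_ /dist_le_walk].
  by rewrite /x tE last_cat => /leq_trans; apply; rewrite size_take; case: ltnP.
move=> s t /andP[st tL].
(* The bounds from [le] on the segments from [v0] to [x s], to [x t], to [w] add up to [dist v0 w],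
   so each of them is attained. *)
have x0 : x 0 = v0 by rewrite /x take0.
have xp : x (size p) = w by rewrite /x take_size.
have a := le 0 s isT; have b := le s t st; have c := le t (size p).
have d := dist_triangle (x s) v0 w; have f := dist_triangle (x t) (x s) w.
move: a b c d f; rewrite x0 xp -sp; lia.
Qed.

End GraphDistance.

(** * Pigeonhole and congruences *)

Lemma pigeonhole3 N (f : 'I_N.*2.+1 -> 'I_N) :
  exists i j k : 'I_N.*2.+1, [/\ i < j, j < k, f i = f j & f k = f j].
Proof.
suff [c] : exists c, 2 < #|[pred i | f i == c]|.
  case/card_gt2P => x [y [z [[/eqP fx /eqP fy /eqP fz] [xy yz zx]]]].
  have sort3 (i j k : 'I_N.*2.+1) : i < j -> j < k -> f i = c -> f j = c -> f k = c ->
      exists i j k : 'I_N.*2.+1, [/\ i < j, j < k, f i = f j & f k = f j].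
    by move=> ij jk fi fj fk; exists i, j, k; rewrite fi fj fk.
  move: xy yz zx; rewrite -!val_eqE /=.
  case: (ltngtP x y) => // ? _; case: (ltngtP y z) => // ? _;
    case: (ltngtP z x) => // ? _; solve [exact: (sort3 x y z)
      |exact: (sort3 x z y)|exact: (sort3 y x z)|exact: (sort3 y z x)
      |exact: (sort3 z x y)|exact: (sort3 z y x)|lia].
(* Fibres with at most two elements would account for at most [2N] of the [2N + 1] indices. *)
apply: contrapT => /forallNP small.
have : #|'I_N.*2.+1| = \sum_(c < N) #|[pred i | f i == c]|.
  rewrite -sum1_card (partition_big f predT) //=.
  by apply: eq_bigr => c _; rewrite sum1_card.
have : \sum_(c < N) #|[pred i | f i == c]| <= \sum_(c < N) 2.
  by apply: leq_sum => c _; rewrite leqNgt; apply/negP; exact: small.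
rewrite sum_nat_const !card_ord; lia.
Qed.

(** Congruent numbers with distinct quotients differ by at least [M], which exceeds [k]. *)
Lemma eq_of_modn_near M k a b :
  a %% M = b %% M -> a <= b + k -> b <= a + k -> k < M -> a = b.
Proof.
move=> ab le1 le2 kM; have := divn_eq a M; have := divn_eq b M; rewrite ab.
case: (ltngtP (a %/ M) (b %/ M)) => [lt|lt|->]; last by lia.
  by have := leq_mul2r M (a %/ M).+1 (b %/ M); rewrite lt orbT mulSn; lia.
by have := leq_mul2r M (b %/ M).+1 (a %/ M); rewrite lt orbT mulSn; lia.
Qed.

(** * Induced structures and embeddings *)

Definition pullback (L : language) (U W : Type) (x : U -> W)
    (J : interp L W) : interp L U :=
  fun k s => [set t | J k s (map_tuple x t)].

Lemma embedding_pullback (L : language) (U W : Type) (x : U -> W)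
    (J : interp L W) : injective x -> embedding (pullback x J) J x.
Proof. by move=> xI; split. Qed.

Lemma embedding_comp (L : language) (U W X : Type) (I : interp L U)
    (J : interp L W) (K : interp L X) (f : U -> W) (g : W -> X) :
  embedding I J f -> embedding J K g -> embedding I K (g \o f).
Proof.
move=> [fI fE] [gI gE]; split=> [|k s t]; first exact: inj_comp.
rewrite -fE -gE.
suff -> : map_tuple (g \o f) t = map_tuple g (map_tuple f t) by [].
by apply: val_inj; rewrite /= map_comp.
Qed.

Lemma embedding_reduct (L Lp : language) (i : sublanguage L Lp) (U W : Type)
    (I : interp Lp U) (J : interp Lp W) (f : U -> W) :
  embedding I J f -> embedding (reduct_interp i I) (reduct_interp i J) f.
Proof. by move=> [fI fE]; split=> // k s t; exact: fE. Qed.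

(** The relations of [I] determine all distances in the image of an embedding; hence a copy of a
    geodesic is again a geodesic. *)
Lemma embedding_metric_dist (V : eqType) (e : rel V)
    (e_conn : connected_on e [set: V]) (U : Type) (I : interp dist_lang U)
    (f g : U -> V) :
  embedding I (metric_interp e) f -> embedding I (metric_interp e) g ->
  forall a b, dist e_conn (f a) (f b) = dist e_conn (g a) (g b).
Proof.
move=> [_ fE] [_ gE] a b.
have := fE _ (Dist (dist e_conn (g a) (g b))) [tuple a; b].
have := gE _ (Dist (dist e_conn (g a) (g b))) [tuple a; b].
rewrite /= !(tnth_nth (f a)) /= => ga fa.
by apply/graph_distP; apply/fa; apply/ga; apply/graph_distP.
Qed.

(** Equality, not just isomorphism, of the one-point structures puts all their expansions into one
    and the same finite set. *)
Lemma metric_interp_const (V : eqType) (e : rel V) (x y : V) :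
  connected_on e [set: V] ->
  pullback (fun _ : unit => x) (metric_interp e) =
  pullback (fun _ : unit => y) (metric_interp e).
Proof.
move=> e_conn; apply: functional_extensionality_dep => k; apply: funext => s.
apply/seteqP; case: s => d; split=> t; rewrite /pullback /= !tnth_map;
  by move=> /(graph_distP e_conn) <-; apply/(graph_distP e_conn); rewrite !dist_xx.
Qed.

(** * The Ramsey argument with distances to a root *)

Theorem theorem8p6 (m n : enat) (hm : ge2 m) (hn : ge2 n)
    (V : countType) (e : rel V) (hT : @is_T m n V e) :
  ~ has_precompact_ramsey_expansion (age_T e).
Proof.
case: hT => e_sym _ [v0 _] e_conn e_blocks e_cut _.
pose d := dist e_conn.
case=> Lp [i [Kp [Kher Kexp Kpre Kram]]].
pose point v := FStruct (pullback (fun _ : unit => v) (metric_interp e)).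
have age_point v : age_T e (point v).
  by exists (fun=> v); apply: embedding_pullback => -[] [].
(* [code] numbers the expansions of the one-point structure injectively by integers below [N]. *)
have [N /card_set_bijP[code [codeN codeI _]]] := Kpre _ (age_point v0).
have [x dx] := geodesic_exists e_sym e_conn e_cut v0 N.*2.
pose x' (t : 'I_N.*2.+1) := x t.
pose A0 := FStruct (pullback x' (metric_interp e)).
have xI : injective x'.
  move=> s t xst; apply: ord_inj; move: (ltn_ord s) (ltn_ord t).
  rewrite /x' in xst; have := dx s t; have := dx t s; rewrite xst !dist_xx; lia.
have /Kexp[B KB BA0] : age_T e A0.
  by exists x'; exact: embedding_pullback.
(* [BA0] equates structures over different carriers, so the geodesic is
   transported to [B] before [A0] is forgotten. *)
have [b [y [yE bx]]] :
    exists (b : 'I_N.*2.+1 -> fdom (reduct i B)) (y : fdom (reduct i B) -> V),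
      embedding (@Defs.frel _ (reduct i B)) (metric_interp e) y /\
      forall t, y (b t) = x t.
  by rewrite BA0; exists id, x'; split=> //; exact: embedding_pullback.
pose J t := pullback (fun _ : unit => b t) (@Defs.frel _ B).
have bE t : embedding (J t) (@Defs.frel _ B) (fun _ : unit => b t).
  by apply: embedding_pullback; case=> [] [].
have KJ t : Kp (FStruct (J t)) by apply: Kher KB; exists (fun=> b t); exact: bE.
have J_expands t : [set I | Kp (FStruct I) /\
    reduct_interp i I = @Defs.frel _ (point v0)] (J t).
  split=> //; rewrite /= (@metric_interp_const _ _ v0 (x t) e_conn) -bx.
  apply: functional_extensionality_dep => k; apply: funext => s.
  have [_ yk] := yE; apply: funext => u; apply: propext.
  apply: (iff_trans (iff_sym (yk k s (map_tuple (fun=> b t) u)))).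
  suff -> : map_tuple y (map_tuple (fun=> b t) u) = map_tuple (fun=> y (b t)) u by [].
  by apply: val_inj; rewrite /= -map_comp.
pose f t : 'I_N := Ordinal (codeN _ (J_expands t)).
have [p [q [r [pq qr fpq frq]]]] := pigeonhole3 f.
have JE s t : f s = f t -> J s = J t.
  by move=> /(congr1 val) /=; apply: codeI; rewrite inE.
have [C KC mono] := Kram _ _ (KJ q) KB N.*2.+1 isT.
have [g gE] : age_T e (reduct i C) by apply/Kexp; exists C.
(* Only the values on singletons matter; [ord0] is a filler for the empty set. *)
pose chi (S : {set fdom C}) : 'I_N.*2.+1 :=
  if [pick u in S] is Some u then inord (d v0 (g u) %% N.*2.+1) else ord0.
have chi1 u : val (chi [set u]%SET) = d v0 (g u) %% N.*2.+1.
  rewrite /chi; case: pickP => [w|/(_ u)]; rewrite inE ?eqxx // => /eqP ->.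
  by rewrite /= inordK // ltn_pmod.
have [S [h hE ->] [c chic]] := mono chi.
(* As [J t = J q], the singleton of [h (b t)] is a copy of the coloured structure inside the
   monochromatic copy of [B]. *)
have level t : f t = f q -> d v0 (g (h (b t))) %% N.*2.+1 = c.
  move=> ft; rewrite -chi1 chic //; last by rewrite finset.sub1set imset_f.
  exists (fun=> h (b t)); first by rewrite -(JE _ _ ft); exact: embedding_comp (bE t) hE.
  by apply/setP => u; rewrite inE; apply/eqP/imsetP => [->|[_ _ ->]//]; exists tt.
pose z t := g (h (b t)).
(* Both [y] and [g \o h] embed the reduct of [B], so [z] inherits the distances of the geodesic
   [x]. *)
have dz (s t : 'I_N.*2.+1) : s <= t -> d (z s) (z t) = t - s.
  move=> st; have := embedding_metric_dist e_conn
    (embedding_comp (embedding_reduct i hE) gE) yE (b s) (b t).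
  by rewrite /= !bx dx // st -ltnS ltn_ord.
have equidistant (s t : 'I_N.*2.+1) : s <= t -> f s = f q -> f t = f q -> d v0 (z s) = d v0 (z t).
  move=> st /level ls /level lt; have := dz _ _ st.
  have := dist_triangle e_conn (z s) v0 (z t).
  have := dist_triangle e_conn (z t) v0 (z s).
  rewrite (dist_sym e_sym e_conn (z t)) -/d => t1 t2 dst.
  (* By the triangle inequality the two distances are at most [t - s <= 2N] apart. *)
  apply: (eq_of_modn_near (k := t - s) (M := N.*2.+1)); first by rewrite [LHS]ls.
  - by lia.
  - by lia.
  - by move: (ltn_ord t); lia.
have neq (s t : 'I_N.*2.+1) : s < t -> z s <> z t.
  by move=> st zst; have := dz _ _ (ltnW st); rewrite zst /d dist_xx; lia.
apply: (not_three_equidistant e_sym (e_conn := e_conn) _ (neq _ _ pq) (neq _ _ qr)).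
- by move=> S' /e_blocks[].
- rewrite -/d !dz; lia.
- by apply: equidistant => //; exact: ltnW.
- by symmetry; apply: equidistant => //; exact: ltnW.
Qed.
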